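(* Let $q$ be a power of an odd prime, let $m\ge 1$ be an integer, let $c\in\mathbb{F}_q\setminus\{0\}$ and let $\varepsilon\in\{1,-1\}$. Then the polycyclic code $C$ over $\mathbb{F}_q$ of length $2m$ associated with the trinomial $x^{2m}+2\varepsilon c x^m+c^2$ and generated by $g(x)=x^m+\varepsilon c$ is isodual.
   Context: Vectors $(c_0,\dots,c_{n-1})\in\mathbb{F}_q^n$ are identified with polynomials $c_0+c_1x+\cdots+c_{n-1}x^{n-1}$. For a monic polynomial $f(x)\in\mathbb{F}_q[x]$ of degree $n$ and a monic divisor $g(x)$ of $f(x)$, the polycyclic code associated with $f(x)$ and generated by $g(x)$ is the ideal $\langle g(x)\rangle$ of $\mathbb{F}_q[x]/\langle f(x)\rangle$, i.e. the set of all multiples of $g(x)$ of degree less than $n$, viewed as a linear code of length $n$. Two linear codes $C_1,C_2$ of length $n$ over $\mathbb{F}_q$ are equivalent if there is a monomial $n\times n$ matrix $M$ over $\mathbb{F}_q$ (exactly one non-zero entry in each row and each column) with $C_2=\{cM: c\in C_1\}$. The dual $C^\perp$ is taken with respect to the Euclidean inner product; $C$ is isodual if $C$ is equivalent to $C^\perp$. *)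

(* Defs.v *)
From HB Require Import structures.
From mathcomp Require Import all_boot all_order all_algebra all_field.

Set Implicit Arguments.
Unset Strict Implicit.
Unset Printing Implicit Defensive.

Import GRing.Theory Pdiv.Field.
Local Open Scope ring_scope.

Section Codes.

Variables (F : finFieldType) (n : nat).

(* A vector v is identified with the polynomial rVpoly v; the codewords are   *)
(* the vectors whose class in F[x]/<f> lies in the ideal <g>. Meaningful for  *)
(* f monic of degree n >= 1: otherwise {poly %/ f} falls back to F[x]/<x>, or *)
(* length n vectors do not match the residues mod f. Lemma mem_polycyclic     *)
(* gives the description by multiples of g.                                   *)
Definition polycyclic_code (f g : {poly F}) : {set 'rV[F]_n} :=
  [set v : 'rV[F]_n | [exists a : {poly %/ f},
              in_qpoly f (rVpoly v) == a * in_qpoly f g]].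

Definition dual_code (C : {set 'rV[F]_n}) : {set 'rV[F]_n} :=
  [set v : 'rV[F]_n |
     [forall u : 'rV[F]_n in C, \sum_(i < n) u 0 i * v 0 i == 0]].

Definition monomial_mx (M : 'M[F]_n) : bool :=
  [forall i, #|[set j | M i j != 0]| == 1%N] &&
  [forall j, #|[set i | M i j != 0]| == 1%N].

Definition code_equiv (C1 C2 : {set 'rV[F]_n}) : Prop :=
  exists2 M : 'M[F]_n, monomial_mx M & C2 = [set c *m M | c in C1].

Definition isodual (C : {set 'rV[F]_n}) : Prop := code_equiv C (dual_code C).

Lemma mem_polycyclic (f g : {poly F}) (v : 'rV[F]_n) :
    (0 < n)%N -> f \is monic -> size f = n.+1 -> g %| f ->
  (v \in polycyclic_code f g) = (g %| rVpoly v).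
Proof.
move=> n_gt0 f_mon sz_f g_f.
have mkf : mk_monic f = f by rewrite /mk_monic sz_f ltnS n_gt0 f_mon.
have lt_v : (size (rVpoly v) < size (mk_monic f))%N.
  by rewrite mkf sz_f ltnS size_poly.
have modE (p : {poly F}) : in_qpoly f p = p %% f :> {poly F}.
  by rewrite /= mkf -Pdiv.IdomainMonic.modpE.
rewrite inE; apply/existsP/idP => [[a /eqP Ea]|/dvdpP[b vE]].
  have -> : rVpoly v = (a * in_qpoly f g : {poly %/ f}) :> {poly F}.
    by rewrite -Ea in_qpoly_small.
  have g_q : g %| in_qpoly f g by rewrite modE -dvdp_mod.
  have mon_mk : mk_monic f \is monic by rewrite mkf.
  rewrite poly_of_qpolyM -Pdiv.IdomainMonic.modpE //.
  by rewrite -dvdp_mod ?mkf // dvdp_mull.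
by exists (in_qpoly f b); rewrite vE in_qpolyM.
Qed.

End Codes.

Arguments polycyclic_code {F} n f g.

(* Main.v *)
Require Import Defs.
From mathcomp Require Import all_boot all_order all_algebra all_field.
Import GRing.Theory.
Local Open Scope ring_scope.

(** Put d = eps c, so that the trinomial is (x^m + d)^2. Cutting a word into
    two halves of length m, the multiples of x^m + d are the words (d b | b),
    and the words orthogonal to all of them are the words (a | - d a). The
    monomial map (a | b) |-> (b | - a) sends the former onto the latter. *)

Lemma rVpoly_sum {R : nzRingType} n (v : 'rV[R]_n) :
  rVpoly v = \sum_i v 0 i *: 'X^i.
Proof.
rewrite [in LHS](row_sum_delta v) linear_sum; apply: eq_bigr => i _.
by rewrite linearZ /= rVpoly_delta.
Qed.

Lemma rVpoly_row_mx {R : nzRingType} m n (a : 'rV[R]_m) (b : 'rV[R]_n) :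
  rVpoly (row_mx a b) = rVpoly a + rVpoly b * 'X^m.
Proof.
rewrite !rVpoly_sum big_split_ord mulr_suml; congr (_ + _).
  by apply: eq_bigr => i _; rewrite row_mxEl.
by apply: eq_bigr => i _; rewrite row_mxEr -scalerAl -exprD [(i + m)%N]addnC.
Qed.

(** Modulo ['X^m + d%:P] the upper half [b] folds back as [- d *: b], leaving the polynomial of
    [a - d *: b]. Its degree is below [m], so it is divisible only when it vanishes. *)
Lemma dvdp_rVpoly_row_mx {F : fieldType} m (d : F) (a b : 'rV[F]_m) :
    (0 < m)%N ->
  ('X^m + d%:P %| rVpoly (row_mx a b)) = (a == d *: b).
Proof.
move=> m_gt0.
have -> : rVpoly (row_mx a b) =
    rVpoly (a - d *: b) + rVpoly b * ('X^m + d%:P).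
  by rewrite rVpoly_row_mx linearB linearZ /= mulrDr -mul_polyC
       [_ * d%:P]mulrC addrACA [- _ + _]addrC subrr addr0.
rewrite dvdp_addl ?dvdp_mulIr // -[a == _]subr_eq0.
apply/idP/eqP => [g_dvd|->]; last by rewrite linear0 dvdp0.
apply: (can_inj rVpolyK); rewrite linear0; apply: contraTeq g_dvd => nz.
by rewrite gtNdvdp // size_XnaddC // ltnS size_poly.
Qed.

Definition half_swap_mx (R : pzRingType) m : 'M[R]_(m + m) :=
  block_mx 0 (- 1%:M) 1%:M 0.

Lemma mul_row_half_swap {R : pzRingType} m (a b : 'rV[R]_m) :
  row_mx a b *m half_swap_mx R m = row_mx b (- a).
Proof. by rewrite mul_row_block !mulmx0 mulmxN !mulmx1 add0r addr0. Qed.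

Lemma monomial_half_swap (F : finFieldType) m : monomial_mx (half_swap_mx F m).
Proof.
have nz (x y : 'I_m) : ((x == y)%:R != 0 :> F) = (x == y).
  by case: (x == y); rewrite ?mulr1n ?mulr0n ?oner_eq0 ?eqxx.
apply/andP; split; apply/forallP=> i; apply/cards1P;
  have [l ->|l ->] := split_ordP i;
  (* The nonzero blocks are off-diagonal and equal to plus or minus the identity, so the only
     nonzero entry has the same index [l] in the opposite half. The first two witnesses serve rows,
     the last two columns. *)
  [exists (rshift m l)|exists (lshift m l)|
   exists (rshift m l)|exists (lshift m l)];
  apply/setP=> j; rewrite !inE; case: (split_ordP j) => t ->;
  rewrite ?block_mxEul ?block_mxEur ?block_mxEdl ?block_mxEdr !mxE
    ?oppr_eq0 ?nz ?eqxx ?eq_lrshift ?eq_rlshift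
    ?eq_lshift ?eq_rshift //; exact: eq_sym.
Qed.

(** Pairing [row_mx (d *: y) y] with [row_mx a b] amounts to pairing [y] with [d *: a + b]. As [y]
    is arbitrary, orthogonality forces this vector to be zero. *)
Lemma dual_graph (F : finFieldType) m (d : F) (C : {set 'rV[F]_(m + m)})
    (a b : 'rV[F]_m) :
    (forall x y : 'rV[F]_m, (row_mx x y \in C) = (x == d *: y)) ->
  (row_mx a b \in dual_code C) = (b == - (d *: a)).
Proof.
move=> CE.
have dotE (y : 'rV[F]_m) : \sum_(i < m + m)
    (row_mx (d *: y) y) 0 i * (row_mx a b) 0 i = \sum_i y 0 i * (d *: a + b) 0 i.
  rewrite big_split_ord /= -big_split; apply: eq_bigr => i _ /=.
  by rewrite !row_mxEl !row_mxEr !mxE mulrDr mulrA [d * y 0 i]mulrC.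
rewrite -addr_eq0 addrC inE; apply/forall_inP/eqP => [orth|ab0 u].
  apply/rowP=> j; rewrite [RHS]mxE.
  (* Taking a unit vector for [y] isolates coordinate [j] of [d *: a + b]. *)
  have := orth (row_mx (d *: delta_mx 0 j) (delta_mx 0 j)).
  rewrite CE eqxx dotE => /(_ isT) /eqP.
  rewrite (bigD1 j) //= big1 ?addr0 => [|i /negPf ij].
    by rewrite [delta_mx _ _ _ _]mxE !eqxx mul1r.
  by rewrite [delta_mx _ _ _ _]mxE ij mul0r.
rewrite -[u]hsubmxK CE => /eqP ->; rewrite dotE ab0 big1 // => i _.
by rewrite [X in _ * X]mxE mulr0.
Qed.

Lemma isodual_graph (F : finFieldType) m (d : F) (C : {set 'rV[F]_(m + m)}) :
    (forall x y : 'rV[F]_m, (row_mx x y \in C) = (x == d *: y)) ->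
  isodual C.
Proof.
move=> CE; exists (half_swap_mx F m); first exact: monomial_half_swap.
apply/setP=> v; rewrite -[v]hsubmxK (dual_graph _ _ d) //.
apply/eqP/imsetP => [->|[u]].
  (* The preimage of [(a | - d a)] under the half swap is [(d a | a)]. *)
  exists (row_mx (d *: lsubmx v) (lsubmx v)); first by rewrite CE.
  by rewrite mul_row_half_swap.
rewrite -[u]hsubmxK CE => /eqP ->.
by rewrite mul_row_half_swap => /eq_row_mx[-> ->].
Qed.

(** The length is a variable [n] with an equation, so that a code of length [2 * m] can be cut by
    [row_mx] at length [m + m] without a cast. *)
Lemma isodual_polycyclic_binomial (F : finFieldType) m n (f : {poly F}) (d : F) :
    (0 < m)%N -> n = (m + m)%N -> f \is monic -> size f = n.+1 ->
    'X^m + d%:P %| f ->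
  isodual (polycyclic_code n f ('X^m + d%:P)).
Proof.
move=> m_gt0 -> f_mon sz_f g_f; apply: (@isodual_graph _ _ d) => x y.
by rewrite mem_polycyclic ?addn_gt0 ?m_gt0 // dvdp_rVpoly_row_mx.
Qed.

Theorem theorem4p1 (p k : nat) (F : finFieldType) (m : nat) (c eps : F)
    (p_prime : prime p) (p_odd : odd p) (k_gt0 : (0 < k)%N)
    (cardF : #|F| = (p ^ k)%N) (m_ge1 : (1 <= m)%N)
    (c_neq0 : c != 0) (epsE : eps = 1 \/ eps = -1) :
  isodual (polycyclic_code (2 * m)%N
             ('X^(2 * m)%N + (2%:R * eps * c) *: 'X^m + (c ^+ 2)%:P)
             ('X^m + (eps * c)%:P)).
Proof.
have g_mon : 'X^m + (eps * c)%:P \is monic by rewrite monicXnaddC.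
have -> : 'X^(2 * m)%N + (2%:R * eps * c) *: 'X^m + (c ^+ 2)%:P =
    ('X^m + (eps * c)%:P) ^+ 2.
  (* The sign enters here: [eps] squares to 1, so the constant term is also the square of
     [eps * c]. *)
  have -> : c ^+ 2 = (eps * c) ^+ 2.
    by case: epsE => ->; rewrite ?mul1r // mulN1r sqrrN.
  rewrite sqrrD -exprM [(m * 2)%N]mulnC -rmorphXn; congr (_ + _ + _).
  by rewrite -mulrA -mul_polyC mulr_natl polyCMn mulrnAl mulrC.
apply: isodual_polycyclic_binomial => //; first by rewrite mul2n addnn.
- exact: monic_exp.
- rewrite expr2 size_monicM ?monic_neq0 // size_XnaddC //.
  by rewrite addnS addSn mul2n addnn.
- by rewrite expr2 dvdp_mulIl.
Qed.
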